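(* The \textsc{Permutation Pattern} problem can be solved in time $n^{\frac{\ell}{2}+o(\ell)}$ and polynomial space, where $\ell=|\sigma|$ and $n=|\pi|$.
   Context: A permutation is a pair $\pi=(S,P)$, $S$ a finite set of positive integers, $P:S\to\mathbb{N}^2$ injective with $P(S)$ in general position (no two points share a coordinate); length $|S|$; reduced if $S=[n]$ and $P(S)\subseteq[n]\times[n]$. For $\alpha\in\{1,2\}$, $p<^{\pi}_{\alpha}p'$ means the $\alpha$-th coordinate of $P(p)$ is smaller than that of $P(p')$. An embedding of $\sigma$ into $\pi$ is $\phi:S(\sigma)\to S(\pi)$ with $p<^{\sigma}_{\alpha}p'\iff\phi(p)<^{\pi}_{\alpha}\phi(p')$ for all $p,p'$ and $\alpha$. \textsc{Permutation Pattern}: given reduced permutations $\sigma$ and $\pi$, decide whether there is an embedding of $\sigma$ into $\pi$. *)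

(* Defs.v *)
From mathcomp Require Import all_boot.
From mathcomp Require Import finmap.

Set Implicit Arguments.
Unset Strict Implicit.
Unset Printing Implicit Defensive.

Local Open Scope nat_scope.

Inductive axis := Axis1 | Axis2.

Definition coord (a : axis) (u : nat * nat) : nat :=
  match a with Axis1 => u.1 | Axis2 => u.2 end.

Record permutation := Permutation {
  labels : {fset nat};
  point : labels -> nat * nat;
  labels_gt0 : forall p : labels, 0 < val p;
  point_inj : injective point;
  point_general : forall (a : axis) (p q : labels),
    p <> q -> coord a (point p) <> coord a (point q) }.

Definition plength (s : permutation) : nat := #|` labels s|.

Definition reduced (s : permutation) : Prop :=
  (forall i : nat, (i \in labels s) = (1 <= i <= plength s)) /\
  (forall (a : axis) (p : labels s), 1 <= coord a (point p) <= plength s).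

Definition plt (s : permutation) (a : axis) (p q : labels s) : Prop :=
  coord a (point p) < coord a (point q).

Definition is_embedding (s t : permutation) (phi : labels s -> labels t) : Prop :=
  forall (a : axis) (p q : labels s), plt a p q <-> plt a (phi p) (phi q).

Definition contains_pattern (s t : permutation) : Prop :=
  exists phi : labels s -> labels t, is_embedding phi.

(* The model of computation is a random access machine with a fixed finite    *)
(* program, finitely many registers (named by constants of the program) and   *)
(* one memory array. Each instruction costs one time unit; the bit length of  *)
(* the words is restricted separately, through [words].                       *)
Inductive instr :=
  | Const of nat & nat
  | Add of nat & nat & nat
  | Sub of nat & nat & nat
  | Read of nat & nat
  | Write of nat & nat
  | JumpZ of nat & nat
  | Accept
  | Reject.

Record config := Config { pc : nat; regs : seq nat; memory : seq nat }.

(* Running past the end of the program counts as rejection. *)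
Definition current (prog : seq instr) (c : config) : instr :=
  nth Reject prog (pc c).

Definition reg (c : config) (r : nat) : nat := nth 0 (regs c) r.

Definition set_reg (c : config) (r v : nat) : config :=
  Config (pc c).+1 (set_nth 0 (regs c) r v) (memory c).

(* Halting configurations are fixed points of [step]. *)
Definition step (prog : seq instr) (c : config) : config :=
  match current prog c with
  | Const r v => set_reg c r v
  | Add r a b => set_reg c r (reg c a + reg c b)
  | Sub r a b => set_reg c r (reg c a - reg c b)
  | Read r a => set_reg c r (nth 0 (memory c) (reg c a))
  | Write a b =>
      Config (pc c).+1 (regs c) (set_nth 0 (memory c) (reg c a) (reg c b))
  | JumpZ r l =>
      Config (if reg c r == 0 then l else (pc c).+1) (regs c) (memory c)
  | Accept | Reject => c
  end.

Definition run (prog : seq instr) (input : seq nat) (t : nat) : config :=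
  iter t (step prog) (Config 0 [::] input).

Definition decides_at (prog : seq instr) (input : seq nat) (A : Prop) (t : nat)
    : Prop :=
  (current prog (run prog input t) = Accept /\ A) \/
  (current prog (run prog input t) = Reject /\ ~ A).

Definition bits (v : nat) : nat := (trunc_log 2 v).+1.

(* Since [set_nth] pads with zeros, every cell below the highest address      *)
(* written so far occurs here, and costs at least one bit of space.           *)
Definition words (c : config) : seq nat := regs c ++ memory c.

Definition space_used (c : config) : nat := \sum_(v <- words c) bits v.

(* The default value is never reached on a reduced permutation for 1 <= i <= n *)
Definition point_at (s : permutation) (i : nat) : nat * nat :=
  if insub i is Some p then @point s p else (0, 0).

Definition encode_points (s : permutation) : seq nat :=
  flatten [seq [:: (point_at s i).1; (point_at s i).2]
          | i <- iota 1 (plength s)].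

Definition encode (s t : permutation) : seq nat :=
  [:: plength s, plength t & encode_points s ++ encode_points t].

(* Main.v *)
Require Import Defs.
From mathcomp Require Import all_boot all_order all_algebra.
From mathcomp Require Import classical_sets functions filter reals topology normedtype landau exp.
From mathcomp Require Import zify finmap.
Import Order.TTheory GRing.Theory Num.Theory.
Import numFieldNormedType.Exports.

Set Implicit Arguments.
Unset Strict Implicit.
Unset Printing Implicit Defensive.

(* Guess the x-coordinates of the images of the points of sigma whose
   x-coordinate is even. The image of each remaining point is then confined to
   the open vertical strip between the images of its two neighbours; these
   strips are disjoint and come in the right order, so only the order of the
   values remains to be respected, and matching the values of sigma greedily,
   from the bottom up, decides whether the guess extends to an embedding. The
   guesses are enumerated in place by a counter with l./2 digits in base n + 1,
   and (n + 1) ^ l./2 <= 2 * n ^ l./2 as l <= n. *)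

(** Greedy matching is exact because compatibility of two values depends only on the fixed table,
    never on earlier matches. No separate test checks that the guessed images increase: every odd
    point must land strictly between its two neighbouring entries, and this alone forces the order.
    The base is n + 1 because the digit 0 doubles as the mark of a free entry. Hence zero-padded
    memory, once the sentinel at position l + 1 is written, is already the first guess, and a guess
    that contains a digit 0 can never succeed. A guess costs O(n ^ 2) instructions, since each of
    the n values needs two linear searches; this factor is the whole o(l) term, a constant 2 in the
    exponent. Inputs with l > n are rejected at once: they have no embedding, and the comparison of
    (n + 1) ^ l./2 with n ^ l./2 relies on l <= n. *)

(* Registers: 1, 2 hold the constants 1, 2; 3 and 4 hold l and n, 5 and 6 hold
   l + 1 and n + 1; 7 is the address of the last y-coordinate of sigma, 8 the
   address of the table f, 9 the address of f (l + 1); 10 is the value y being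
   scanned in pi, 11 the next value v to be matched in sigma, 12 an address,
   15 and 16 the x-coordinates of the points of pi and sigma with values y and
   v. Entry points: 15 test of one table, 17 scanning loop, 23 and 33 linear
   searches in pi and sigma, 42 compatibility test, 58 match, 60 incrementation
   of the table, 72 rejection, 73 acceptance. *)
Definition matcher : seq instr :=
  [:: Const 16 0; Const 1 1; Const 2 2; Read 3 0; Read 4 1;
      Defs.Sub 13 3 4; JumpZ 13 8; Reject;
      Add 5 3 1; Add 6 4 1; Add 7 3 5; Add 8 7 4; Add 8 8 6; Add 9 8 5;
      Write 9 6;
      Const 10 0; Const 11 1;
      Defs.Sub 13 5 11; JumpZ 13 73; Add 10 10 1; Defs.Sub 13 6 10; JumpZ 13 60;
      Add 12 7 0;
      Add 12 12 2; Read 13 12; Defs.Sub 14 13 10; Defs.Sub 13 10 13; Add 14 14 13;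
      JumpZ 14 30; JumpZ 0 23; Defs.Sub 12 12 1; Read 15 12;
      Add 12 1 0;
      Add 12 12 2; Read 13 12; Defs.Sub 14 13 11; Defs.Sub 13 11 13; Add 14 14 13;
      JumpZ 14 40; JumpZ 0 33; Defs.Sub 12 12 1; Read 16 12;
      Add 12 8 16; Read 13 12; JumpZ 13 50;
      Defs.Sub 14 13 15; Defs.Sub 13 15 13; Add 14 14 13; JumpZ 14 58; JumpZ 0 17;
      Defs.Sub 14 12 1; Read 13 14; Defs.Sub 13 15 13; JumpZ 13 17;
      Add 14 12 1; Read 13 14; Defs.Sub 13 13 15; JumpZ 13 17;
      Add 11 11 1; JumpZ 0 17;
      Add 12 8 0;
      Add 12 12 2; Defs.Sub 13 9 12; JumpZ 13 72; Read 13 12; Defs.Sub 14 4 13;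
      JumpZ 14 70; Add 13 13 1; Write 12 13; JumpZ 0 15;
      Write 12 0; JumpZ 0 61;
      Reject;
      Accept].

(** * Executions of bounded length under an invariant *)

Section Evaluation.
Variables (prog : seq instr) (G : pred config).

(** An upper bound [b] instead of an exact time lets branches of different lengths share one budget.
    With [Q] arbitrary, a program fragment is specified by its exits, and its cost is added to the
    budget of what follows. The invariant [G] carries the space bounds. *)
Definition ev (b : nat) (c : config) (Q : config -> Prop) : Prop :=
  exists2 t, t <= b &
    Q (iter t (step prog) c) /\ forall i, i <= t -> G (iter i (step prog) c).

Lemma ev_done (b : nat) (c : config) (Q : config -> Prop) :
  G c -> Q c -> ev b c Q.
Proof. by move=> Gc Qc; exists 0 => //; split=> // -[]. Qed.

Lemma ev_step (b : nat) (c c' : config) (Q : config -> Prop) :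
  G c -> step prog c = c' -> ev b c' Q -> ev b.+1 c Q.
Proof.
move=> Gc <- [t le_tb [Qt Gt]]; exists t.+1 => //; rewrite iterSr; split=> //.
by case=> [//|i] lt_it; rewrite iterSr; apply: Gt.
Qed.

Lemma ev_le (b b' : nat) (c : config) (Q : config -> Prop) :
  ev b c Q -> b <= b' -> ev b' c Q.
Proof. by move=> [t le_tb Qt] le_bb'; exists t => //; apply: leq_trans le_bb'. Qed.

End Evaluation.

(** * Memory layout, compatibility and greedy matching *)

Definition bounded (m k : nat) (c : config) : bool :=
  [&& size (regs c) <= 17, all (leq^~ m) (regs c),
      size (memory c) <= k & all (leq^~ m) (memory c)].

Definition flat (s : seq (nat * nat)) : seq nat :=
  flatten [seq [:: p.1; p.2] | p <- s].

Lemma size_flat (s : seq (nat * nat)) : size (flat s) = 2 * size s.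
Proof. by elim: s => //= p s IHs; rewrite IHs; lia. Qed.

Lemma nth_flat (s : seq (nat * nat)) (i : nat) :
  (nth 0 (flat s) (2 * i) = (nth (0, 0) s i).1) *
  (nth 0 (flat s) (2 * i).+1 = (nth (0, 0) s i).2).
Proof.
elim: s i => [|p s IHs] [|i] //.
by rewrite mulnS -[flat _]/[:: p.1, p.2 & flat s] /= !IHs.
Qed.

Lemma set_nth_cat (s1 s2 : seq nat) (u v : nat) :
  set_nth 0 (s1 ++ s2) (size s1 + u) v = s1 ++ set_nth 0 s2 u v.
Proof. by elim: s1 => //= x s1 ->. Qed.

Lemma set_nth_mkseq (f : nat -> nat) (k u v : nat) : u < k ->
  set_nth 0 (mkseq f k) u v = mkseq [eta f with u |-> v] k.
Proof.
move=> lt_uk; apply: (@eq_from_nth _ 0).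
  by rewrite size_set_nth !size_mkseq; lia.
move=> i; rewrite size_set_nth !size_mkseq nth_set_nth /= => lt_i.
by rewrite !nth_mkseq //; lia.
Qed.

Definition lookup (s : seq (nat * nat)) (y : nat) : nat :=
  (nth (0, 0) s (index y (unzip2 s))).1.

(* A zero entry [f u = 0] leaves the image of the point with x-coordinate [u]
   free between the images [f u.-1] and [f u.+1] of its neighbours. *)
Definition fit (f : nat -> nat) (u x : nat) : bool :=
  if f u == 0 then f u.-1 < x < f u.+1 else f u == x.

Fixpoint greedy (f : nat -> nat) (us xs : seq nat) : bool :=
  match us, xs with
  | [::], _ => true
  | _, [::] => false
  | u :: us', x :: xs' => greedy f (if fit f u x then us' else us) xs'
  end.

(** * Counters in base n + 1 *)

Fixpoint digit (b c i : nat) : nat :=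
  if i is i'.+1 then digit b (c %/ b) i' else c %% b.

Lemma digit_lt (b c i : nat) : digit b.+1 c i < b.+1.
Proof. by elim: i c => /= *; rewrite ?ltn_mod. Qed.

Lemma digit_succ (n c i : nat) :
    (forall j, j < i -> digit n.+1 c j = n) -> digit n.+1 c i <> n ->
  forall j, digit n.+1 c.+1 j =
    if j < i then 0 else if j == i then (digit n.+1 c i).+1 else digit n.+1 c j.
Proof.
elim: i c => [|i IHi] c digit_n digit_i j /=.
  have := divn_eq c n.+1; have := ltn_pmod c (ltn0Sn n).
  move: digit_i => /=; set q := c %/ _; set r := c %% _ => ne_rn lt_rn def_c.
  have [def_q def_r] : c.+1 %/ n.+1 = q /\ c.+1 %% n.+1 = r.+1.
    have -> : c.+1 = q * n.+1 + r.+1 by lia.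
    by rewrite divnMDl // modnMDl divn_small ?modn_small ?addn0 //; lia.
  by case: j => [|j] /=; rewrite ?def_q ?def_r.
have mod_c : c %% n.+1 = n by apply: (digit_n 0).
have def_c := divn_eq c n.+1; rewrite mod_c in def_c.
have [def_q def_r] : c.+1 %/ n.+1 = (c %/ n.+1).+1 /\ c.+1 %% n.+1 = 0.
  have -> : c.+1 = (c %/ n.+1).+1 * n.+1 by lia.
  by rewrite mulnK ?modnMl.
case: j => [|j] /=; first by rewrite def_r.
by rewrite def_q IHi //; move=> k lt_ki; apply: (digit_n k.+1).
Qed.

Lemma digit_surj (n h : nat) (d : nat -> nat) : (forall i, d i <= n) ->
  exists2 c, c < n.+1 ^ h & forall i, i < h -> digit n.+1 c i = d i.
Proof.
elim: h d => [|h IHh] d le_dn; first by exists 0.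
have [c lt_c digit_c] := IHh (d \o succn) (fun i => le_dn i.+1).
exists (c * n.+1 + d 0); first rewrite expnSr.
  by have := leq_mul lt_c (leqnn n.+1); have := le_dn 0; lia.
case=> [|i] /= lt_ih; first by rewrite modnMDl modn_small // ltnS.
by rewrite divnMDl // divn_small ?addn0 ?digit_c // ltnS.
Qed.

(** Justifies the stopping rule: the guesses are exhausted exactly when the carry runs off the
    table. *)
Lemma digit_max (n h c : nat) : c < n.+1 ^ h ->
  (c.+1 == n.+1 ^ h) = all (fun i => digit n.+1 c i == n) (iota 0 h).
Proof.
elim: h c => [|h IHh] c lt_c; first by case: c lt_c.
have def_c := divn_eq c n.+1; have := ltn_pmod c (ltn0Sn n).
rewrite /= -[1]/(1 + 0)%N iotaDl all_map.
rewrite -(eq_all (a1 := fun i => digit n.+1 (c %/ n.+1) i == n)) //.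
have lt_q : c %/ n.+1 < n.+1 ^ h by rewrite ltn_divLR // -expnSr.
rewrite -IHh //; move: lt_q def_c; rewrite expnS.
set q := c %/ _; set r := c %% _; set p := n.+1 ^ h => lt_q def_c lt_r.
have /orP[/eqP def_p|lt_p] : (p == q.+1) || (q.+1 < p) by lia.
  by rewrite {}def_p; apply/idP/idP; nia.
have : n.+1 * q.+2 <= n.+1 * p by rewrite leq_mul2l lt_p orbT.
by move=> ?; apply/idP/idP; lia.
Qed.

(** * Correctness and cost of the machine on two point lists *)

Section Machine.
Variables P Q : seq (nat * nat).
Local Notation l := (size P).
Local Notation n := (size Q).
Hypothesis P_surj : {subset iota 1 l <= unzip2 P}.
Hypothesis Q_surj : {subset iota 1 n <= unzip2 Q}.
Hypothesis P_x : {in P, forall p, 0 < p.1 <= l /\ p.2 <= l}.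
Hypothesis Q_x : {in Q, forall p, 0 < p.1 <= n /\ p.2 <= n}.

Let input : seq nat := [:: l, n & flat P ++ flat Q].
(** [base] is the length of the input, where the table starts, and [k] adds the [l + 2] table
    entries. [m] dominates every address formed, up to [base + l + 2] when the incrementation runs
    off the table. *)
Local Notation m := (4 * (l + n) + 8).
Local Notation k := (3 * l + 2 * n + 4).
Local Notation base := (l + (l + 1) + n + (n + 1)).

Lemma size_input : size input = base.
Proof. by rewrite /= size_cat !size_flat; lia. Qed.

Let mem (f : nat -> nat) : seq nat := input ++ mkseq f (l + 2).

Lemma nth_memP f i : i < l ->
  (nth 0 (mem f) (2 * i + 2) = (nth (0, 0) P i).1) *
  (nth 0 (mem f) (2 * i + 3) = (nth (0, 0) P i).2).
Proof.
move=> lt_il; have [-> ->] : 2 * i + 2 = (2 * i).+2 /\ 2 * i + 3 = (2 * i).+3.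
  by lia.
rewrite /mem /input !cat_cons -catA /=.
by split; rewrite nth_cat size_flat ifT ?nth_flat //; lia.
Qed.

Lemma nth_memQ f j : j < n ->
  (nth 0 (mem f) (2 * l + 2 * j + 2) = (nth (0, 0) Q j).1) *
  (nth 0 (mem f) (2 * l + 2 * j + 3) = (nth (0, 0) Q j).2).
Proof.
move=> lt_jn.
have [-> ->] : 2 * l + 2 * j + 2 = (2 * l + 2 * j).+2 /\
  2 * l + 2 * j + 3 = (2 * l + (2 * j).+1).+2 by lia.
rewrite /mem /input !cat_cons -catA /=.
split; rewrite nth_cat size_flat ifF ?addKn; try by lia.
  by rewrite nth_cat size_flat ifT ?nth_flat //; lia.
by rewrite nth_cat size_flat ifT ?nth_flat //; lia.
Qed.

Lemma nth_memF f u : u < l + 2 -> nth 0 (mem f) (base + u) = f u.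
Proof.
move=> lt_u; rewrite nth_cat size_input ifF; last by lia.
by rewrite addKn nth_mkseq.
Qed.

Lemma set_memF f u v : u < l + 2 ->
  set_nth 0 (mem f) (base + u) v = mem [eta f with u |-> v].
Proof.
by move=> lt_u; rewrite /mem -size_input set_nth_cat set_nth_mkseq.
Qed.

Lemma input_bounded : (size input <= k) && all (leq^~ m) input.
Proof.
rewrite size_input; apply/andP; split; first by lia.
have all_flat s b : {in s, forall p : nat * nat, 0 < p.1 <= b /\ p.2 <= b} ->
    b <= m -> all (leq^~ m) (flat s).
  move=> s_b le_bm; apply/allP => v /flattenP[t /mapP[p /s_b[p1 p2] ->]].
  by rewrite !inE => /orP[] /eqP->; lia.
by rewrite /input /= all_cat (all_flat _ _ P_x) ?(all_flat _ _ Q_x); lia.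
Qed.

Lemma input_state_bounded p r :
  (size r <= 17) && all (leq^~ m) r -> bounded m k (Config p r input).
Proof. by rewrite /bounded input_bounded andbT. Qed.

Lemma mem_bounded f : (forall u, u < l + 2 -> f u <= n + 1) ->
  (size (mem f) <= k) && all (leq^~ m) (mem f).
Proof.
move=> le_f; have /andP[size_k input_m] := input_bounded.
rewrite size_cat size_mkseq all_cat input_m size_input all_map.
apply/andP; split; first by lia.
by apply/allP => u; rewrite mem_iota /= => lt_u; have := le_f u; lia.
Qed.

(** The opening [Const 16 0] fixes the register file at 17 entries. Register 0 is never written, so
    [JumpZ 0] is an unconditional jump. *)
Definition state pc Y V A T D X U f : config :=
  Config pc [:: 0; 1; 2; l; n; l + 1; n + 1; l + (l + 1);
    base; base + (l + 1); Y; V; A; T; D; X; U] (mem f).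

Local Notation EV := (ev matcher (bounded m k)).
Definition bounded_table f := forall u, u < l + 2 -> f u <= n + 1.

Lemma state_bounded pc Y V A T D X U f : bounded_table f ->
  all (leq^~ m) [:: Y; V; A; T; D; X; U] -> bounded m k (state pc Y V A T D X U f).
Proof.
move=> /mem_bounded memf; rewrite /bounded memf andbT /= => ->.
by lia.
Qed.

Ltac exec_instr := eapply ev_step;
  [ by apply: state_bounded; [assumption | rewrite /=; lia]
  | by rewrite /step /current /matcher /set_reg /reg /=; reflexivity
  | ].

Hypothesis le_ln : l <= n.

(** The address enters one point early: each pass first adds 2 and so lands on a y-coordinate, with
    the x-coordinate one cell below. Equality is tested by adding the two truncated differences. A
    failed pass costs 7 instructions. *)
Lemma find_Q b q Y V T D X U f i : bounded_table f ->
  0 < Y <= n -> all (leq^~ m) [:: V; T; D; X; U] ->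
  (forall T' D', T' <= m -> D' <= m ->
    EV b (state 32 Y V (2 * l + 2 * index Y (unzip2 Q) + 2) T' D' (lookup Q Y) U f)
      q) ->
  i <= index Y (unzip2 Q) ->
  EV (b + 7 * (n - i) + 2) (state 23 Y V (2 * l + 2 * i + 1) T D X U f) q.
Proof.
move=> okf Yn small K.
have Y_in : Y \in unzip2 Q by rewrite Q_surj // mem_iota; lia.
move: K; set i0 := index _ _ => K le_i.
have lt_i0 : i0 < n by rewrite -(size_map snd) index_mem.
move def_j : (i0 - i) => j.
elim: j i T D def_j small le_i => [|j IHj] i T D def_j /= small le_i.
  have -> : i = i0 by lia.
  have Q_i0 : (nth (0, 0) Q i0).2 = Y.
    by rewrite -(nth_map _ 0 snd) // nth_index.
  have Q_i0x : (nth (0, 0) Q i0).1 <= n.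
    by have [/andP[]] := Q_x (mem_nth (0, 0) lt_i0).
  eapply ev_le.
    rewrite /state; exec_instr.
    rewrite (_ : _ + 2 = 2 * l + 2 * i0 + 3); last by lia.
    exec_instr; rewrite (nth_memQ f lt_i0) Q_i0.
    do 4 exec_instr; rewrite ifT; last by lia.
    exec_instr; rewrite (_ : _ - 1 = 2 * l + 2 * i0 + 2); last by lia.
    exec_instr; rewrite (nth_memQ f lt_i0).
    by apply: K; lia.
  by lia.
have lt_i : i < i0 by lia.
have lt_in : i < n by lia.
have Q_i : (nth (0, 0) Q i).2 != Y.
  by rewrite -(nth_map _ 0 snd) //; apply: (negbT (before_find _ lt_i)).
have Q_iy : (nth (0, 0) Q i).2 <= n.
  by have [] := Q_x (mem_nth (0, 0) lt_in).
eapply ev_le.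
  rewrite /state; exec_instr.
  rewrite (_ : _ + 2 = 2 * l + 2 * i + 3); last by lia.
  exec_instr; rewrite (nth_memQ f lt_in).
  do 4 exec_instr; rewrite ifF; last by lia.
  exec_instr; rewrite (_ : 2 * l + 2 * i + 3 = 2 * l + 2 * i.+1 + 1); last by lia.
  by apply: IHj => /=; lia.
by lia.
Qed.

Lemma find_P b q Y V T D X U f i : bounded_table f ->
  0 < V <= l -> all (leq^~ m) [:: Y; T; D; X; U] ->
  (forall T' D', T' <= m -> D' <= m ->
    EV b (state 42 Y V (2 * index V (unzip2 P) + 2) T' D' X (lookup P V) f) q) ->
  i <= index V (unzip2 P) ->
  EV (b + 7 * (l - i) + 2) (state 33 Y V (2 * i + 1) T D X U f) q.
Proof.
move=> okf Vl small K.
have V_in : V \in unzip2 P by rewrite P_surj // mem_iota; lia.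
move: K; set i0 := index _ _ => K le_i.
have lt_i0 : i0 < l by rewrite -(size_map snd) index_mem.
move def_j : (i0 - i) => j.
elim: j i T D def_j small le_i => [|j IHj] i T D def_j /= small le_i.
  have -> : i = i0 by lia.
  have P_i0 : (nth (0, 0) P i0).2 = V.
    by rewrite -(nth_map _ 0 snd) // nth_index.
  have P_i0x : (nth (0, 0) P i0).1 <= l.
    by have [/andP[]] := P_x (mem_nth (0, 0) lt_i0).
  eapply ev_le.
    rewrite /state; exec_instr.
    rewrite (_ : _ + 2 = 2 * i0 + 3); last by lia.
    exec_instr; rewrite (nth_memP f lt_i0) P_i0.
    do 4 exec_instr; rewrite ifT; last by lia.
    exec_instr; rewrite (_ : _ - 1 = 2 * i0 + 2); last by lia.
    exec_instr; rewrite (nth_memP f lt_i0).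
    by apply: K; lia.
  by lia.
have lt_i : i < i0 by lia.
have lt_il : i < l by lia.
have P_i : (nth (0, 0) P i).2 != V.
  by rewrite -(nth_map _ 0 snd) //; apply: (negbT (before_find _ lt_i)).
have P_iy : (nth (0, 0) P i).2 <= l.
  by have [] := P_x (mem_nth (0, 0) lt_il).
eapply ev_le.
  rewrite /state; exec_instr.
  rewrite (_ : _ + 2 = 2 * i + 3); last by lia.
  exec_instr; rewrite (nth_memP f lt_il).
  do 4 exec_instr; rewrite ifF; last by lia.
  exec_instr; rewrite (_ : 2 * i + 3 = 2 * i.+1 + 1); last by lia.
  by apply: IHj => /=; lia.
by lia.
Qed.

(** The longest path, of 11 instructions, compares a free entry with both neighbours. *)
Lemma test_fit b q Y V A T D X U f : bounded_table f -> 0 < U <= l -> X <= n ->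
  all (leq^~ m) [:: Y; V; A; T; D] ->
  (forall A' T' D', A' <= m -> T' <= m -> D' <= m ->
     EV b (state (if fit f U X then 58 else 17) Y V A' T' D' X U f) q) ->
  EV (b + 11) (state 42 Y V A T D X U f) q.
Proof.
move=> okf Ul Xn /= small K.
have fU : f U <= n + 1 by apply: okf; lia.
have fU1 : f U.-1 <= n + 1 by apply: okf; lia.
have fU2 : f U.+1 <= n + 1 by apply: okf; lia.
rewrite /fit in K; have [fU0|fU0] := eqVneq (f U) 0.
  rewrite fU0 eqxx in K.
  have [le_Xf|lt_fX] := leqP X (f U.-1).
    rewrite ifF in K; last by lia.
    eapply ev_le.
      rewrite /state; do 2 exec_instr; rewrite nth_memF ?fU0; last by lia.
      do 2 exec_instr; rewrite (_ : base + U - 1 = base + U.-1); last by lia.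
      exec_instr; rewrite nth_memF; last by lia.
      do 2 exec_instr; rewrite ifT; last by lia.
      by apply: K; lia.
    by lia.
  eapply ev_le.
    rewrite /state; do 2 exec_instr; rewrite nth_memF ?fU0; last by lia.
    do 2 exec_instr; rewrite (_ : base + U - 1 = base + U.-1); last by lia.
    exec_instr; rewrite nth_memF; last by lia.
    do 2 exec_instr; rewrite ifF; last by lia.
    exec_instr; rewrite (_ : base + U + 1 = base + U.+1); last by lia.
    exec_instr; rewrite nth_memF; last by lia.
    do 2 exec_instr.
    rewrite (_ : (_ == 0) = ~~ (f U.-1 < X < f U.+1)); last by lia.
    by rewrite if_neg; apply: K; lia.
  by lia.
rewrite (negPf fU0) in K; have [fUX|fUX] := eqVneq (f U) X.
  rewrite fUX eqxx in K.
  eapply ev_le.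
    rewrite /state; do 2 exec_instr; rewrite nth_memF; last by lia.
    exec_instr; rewrite (negPf fU0).
    do 4 exec_instr; rewrite ifT; last by lia.
    by apply: K; lia.
  by lia.
rewrite (negPf fUX) in K.
eapply ev_le.
  rewrite /state; do 2 exec_instr; rewrite nth_memF; last by lia.
  exec_instr; rewrite (negPf fU0).
  do 4 exec_instr; rewrite ifF; last by lia.
  exec_instr; by apply: K; lia.
by lia.
Qed.

Definition values s i j := map (lookup s) (iota i j).

Lemma lookupP s b y : {in s, forall p : nat * nat, 0 < p.1 <= b /\ p.2 <= b} ->
  y \in unzip2 s -> 0 < lookup s y <= b.
Proof.
move=> s_b y_in; rewrite /lookup.
have lt_y : index y (unzip2 s) < size s by rewrite -(size_map snd) index_mem.
by have [] := s_b _ (mem_nth (0, 0) lt_y).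
Qed.

(** The exit tests follow the case order of [greedy]: exhaustion of sigma is tested first, so a
    simultaneous end accepts. The factor [14 * n + 30] pays for two searches, each of at most
    [7 * n + 2] steps as [l <= n], and the fixed work per value. *)
Lemma scan b q Y V A T D X U f : bounded_table f -> Y <= n -> 0 < V <= l + 1 ->
  all (leq^~ m) [:: A; T; D; X; U] ->
  (forall Y' V' A' T' D' X' U', all (leq^~ m) [:: Y'; V'; A'; T'; D'; X'; U'] ->
    EV b (state (if greedy f (values P V (l + 1 - V)) (values Q Y.+1 (n - Y))
              then 73 else 60) Y' V' A' T' D' X' U' f) q) ->
  EV (b + (n - Y).+1 * (14 * n + 30)) (state 17 Y V A T D X U f) q.
Proof.
move=> okf Yn Vl small K; move def_j : (n - Y) => j.
elim: j Y V A T D X U Yn Vl small K def_j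
  => [|j IHj] Y V A T D X U Yn Vl /= small K def_j.
  rewrite def_j in K.
  have [le_lV|lt_Vl] := leqP (l + 1) V.
    rewrite (_ : l + 1 - V = 0) /= in K; last by lia.
    eapply ev_le.
      rewrite /state; do 2 exec_instr; rewrite ifT; last by lia.
      by apply: K; lia.
    by lia.
  rewrite (_ : l + 1 - V = (l - V).+1) /= in K; last by lia.
  eapply ev_le.
    rewrite /state; do 2 exec_instr; rewrite ifF; last by lia.
    do 3 exec_instr; rewrite ifT; last by lia.
    by apply: K; lia.
  by lia.
rewrite def_j in K.
have [le_lV|lt_Vl] := leqP (l + 1) V.
  rewrite (_ : l + 1 - V = 0) /= in K; last by lia.
  eapply ev_le.
    rewrite /state; do 2 exec_instr; rewrite ifT; last by lia.
    by apply: K; lia.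
  by lia.
rewrite (_ : l + 1 - V = (l - V).+1) /= in K; last by lia.
have V_in : V \in unzip2 P by rewrite P_surj // mem_iota; lia.
have Y_in : Y.+1 \in unzip2 Q by rewrite Q_surj // mem_iota; lia.
have /andP[gt0_V le_V] := lookupP P_x V_in.
have /andP[gt0_Y le_Y] := lookupP Q_x Y_in.
have lt_iQ : index Y.+1 (unzip2 Q) < n by rewrite -(size_map snd) index_mem.
have lt_iP : index V (unzip2 P) < l by rewrite -(size_map snd) index_mem.
eapply ev_le.
  rewrite /state; do 2 exec_instr; rewrite ifF; last by lia.
  do 3 exec_instr; rewrite ifF; last by lia.
  exec_instr; rewrite (_ : l + (l + 1) + 0 = 2 * l + 2 * 0 + 1); last by lia.
  rewrite (addn1 Y); eapply find_Q => //=; try by lia.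
  move=> T1 D1 T1m D1m; rewrite /state; exec_instr.
  rewrite (_ : 1 + 0 = 2 * 0 + 1) //.
  eapply find_P => //=; try by lia.
  move=> T2 D2 T2m D2m.
  apply: (@test_fit (b + j.+1 * (14 * n + 30) + 2)) => //=; try by lia.
  move=> A3 T3 D3 A3m T3m D3m; 
  have [fitUX|/negPf fitUX] := boolP (fit f (lookup P V) (lookup Q Y.+1));
    rewrite fitUX in K.
    eapply ev_le.
      rewrite /state; do 2 exec_instr; rewrite (addn1 V).
      apply: IHj => /=; try by lia.
      move=> Y' V' A' T' D' X' U' small'.
      rewrite (_ : l + 1 - V.+1 = l - V); last by lia.
      rewrite (_ : n - Y.+1 = j); last by lia.
      by apply: K.
    by lia.
  eapply ev_le.
    apply: IHj => /=; try by lia.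
    move=> Y' V' A' T' D' X' U' small'.
    rewrite (_ : l + 1 - V = (l - V).+1); last by lia.
    rewrite (_ : n - Y.+1 = j); last by lia.
    by apply: K.
  by lia.
have le_nl : 7 * (l - 0) <= 7 * n by lia.
by rewrite subn0 mulSn; lia.
Qed.

(* The sentinel [n.+1] at [l.+1] bounds the image of the last point when [l] is
   odd. A digit 0 guesses no image, and makes the test of its left neighbour
   fail. *)
Definition guess c u : nat :=
  if u == l.+1 then n.+1
  else if odd u || (u == 0) then 0 else digit n.+1 c (u./2).-1.

Lemma guess_ok c : bounded_table (guess c).
Proof.
move=> u _; rewrite /guess; case: ifP => _; first by lia.
by case: ifP => // _; have := digit_lt n c u./2.-1; lia.
Qed.

Lemma mem_ext f g : (forall u, u < l + 2 -> f u = g u) -> mem f = mem g.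
Proof.
move=> eq_fg; congr (_ ++ _); apply/eq_in_map => u.
by rewrite mem_iota => lt_u; apply: eq_fg; lia.
Qed.

Local Notation h := (l./2).

(** Invariant of the carry: the [i] lowest digits were full and have been reset, so the table
    vanishes up to [2 * i], its odd entries there being 0 anyway. The loop stops on reaching or
    passing the sentinel, which for odd [l] sits where the next digit would be. After an overflow
    the table is left unspecified, since rejection follows. *)
Lemma increment b q c i Y V T D X U : c < n.+1 ^ h -> i <= h ->
  (forall j, j < i -> digit n.+1 c j = n) ->
  all (leq^~ m) [:: Y; V; T; D; X; U] ->
  (forall A' T' D' f', all (leq^~ m) [:: A'; T'; D'] -> bounded_table f' ->
     (c.+1 < n.+1 ^ h -> f' = guess c.+1) ->
     EV b (state (if c.+1 < n.+1 ^ h then 15 else 72) Y V A' T' D' X U f') q) ->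
  EV (b + 10 * (h.+1 - i))
    (state 61 Y V (base + 2 * i) T D X U
       (fun u => if u <= 2 * i then 0 else guess c u)) q.
Proof.
move=> lt_c + + + K; move def_j : (h - i) => j.
elim: j i T D def_j => [|j IHj] i T D def_j le_ih digit_n /= small.
  have ih : i = h by lia.
  have overflow : (c.+1 < n.+1 ^ h) = false.
    apply/negbTE; rewrite -leqNgt leq_eqVlt eq_sym digit_max //.
    apply/orP; left; apply/allP => r; rewrite mem_iota => lt_r.
    by apply/eqP/digit_n; lia.
  rewrite {}overflow in K.
  set f := fun u => _; have okf : bounded_table f.
    by move=> u /(guess_ok c); rewrite /f; case: ifP.
  eapply ev_le.
    rewrite /state; do 3 exec_instr; rewrite ifT; last by lia.
    by apply: K => //=; lia.
  by lia.
have lt_ih : i < h by lia.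
set f := fun u => _; have okf : bounded_table f.
  by move=> u /(guess_ok c); rewrite /f; case: ifP.
have f_i : f (2 * i + 2) = digit n.+1 c i.
  rewrite /f /guess !ifF; try by lia.
  by congr digit; lia.
have le_fi : digit n.+1 c i <= n by have := digit_lt n c i.
have [digit_i|/eqP digit_i] := eqVneq (digit n.+1 c i) n.
  eapply ev_le.
    rewrite /state; exec_instr; rewrite (_ : _ + 2 = base + (2 * i + 2)); last by lia.
    do 2 exec_instr; rewrite ifF; last by lia.
    exec_instr; rewrite nth_memF ?f_i; last by lia.
    do 2 exec_instr; rewrite ifT; last by lia.
    exec_instr; rewrite set_memF; last by lia.
    set f' := [eta f with _ |-> _]; have okf' : bounded_table f'.
      by move=> u lt_u; rewrite /f' /=; case: eqP => // _; apply: okf.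
    exec_instr; rewrite (_ : base + (2 * i + 2) = base + 2 * i.+1); last by lia.
    rewrite (mem_ext (g := fun u => if u <= 2 * i.+1 then 0 else guess c u)).
      apply: IHj => //=; try by lia.
      by move=> r; rewrite ltnS leq_eqVlt => /orP[/eqP->//|]; apply: digit_n.
    move=> u lt_u; rewrite /f' /f /=; case: eqP => [->|ne_u].
      by rewrite ifT //; lia.
    have [le_u|lt_iu] := leqP u (2 * i); first by rewrite ifT //; lia.
    case: leqP => // le_u; rewrite /guess ifF; last by lia.
    by rewrite ifT //; lia.
  by lia.
have no_overflow : c.+1 < n.+1 ^ h.
  rewrite ltn_neqAle lt_c andbT digit_max //; apply/allPn.
  by exists i; [rewrite mem_iota; lia | apply/eqP].
rewrite no_overflow in K.
eapply ev_le.
  rewrite /state; exec_instr; rewrite (_ : _ + 2 = base + (2 * i + 2)); last by lia.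
  do 2 exec_instr; rewrite ifF; last by lia.
  exec_instr; rewrite nth_memF ?f_i; last by lia.
  do 2 exec_instr; rewrite ifF; last by lia.
  do 2 exec_instr; rewrite set_memF; last by lia.
  rewrite (mem_ext (g := guess c.+1)).
    have okg := guess_ok c.+1.
    exec_instr; apply: K => //=; lia.
  move=> u lt_u; rewrite /f /guess /= (digit_succ digit_n digit_i).
  case: eqP => [->|ne_u].
    rewrite (_ : (2 * i + 2)./2.-1 = i); last by lia.
    by rewrite ltnn eqxx !ifF; lia.
  case: eqP => [->|ne_ul]; first by rewrite ifF //; lia.
  case: ifP => [le_u|lt_iu]; case: ifP => // odd_u.
    by rewrite ifT //; lia.
  by rewrite !ifF //; lia.
by lia.
Qed.


Definition accepting c := greedy (guess c) (values P 1 l) (values Q 1 n).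

Definition answer c : Prop :=
  (current matcher c = Accept /\ exists2 g, g < n.+1 ^ h & accepting g) \/
  (current matcher c = Reject /\ ~ exists2 g, g < n.+1 ^ h & accepting g).

(** The surplus of 15 per value over the factor in [scan] pays for the incrementation and the fixed
    overhead of a guess. *)
Lemma search b c Y V A T D X U : b = n.+1 ^ h - c -> c < n.+1 ^ h ->
  all (leq^~ m) [:: Y; V; A; T; D; X; U] ->
  (forall c', c' < c -> ~~ accepting c') ->
  EV (b * (n.+1 * (14 * n + 45))) (state 15 Y V A T D X U (guess c)) answer.
Proof.
elim: b c Y V A T D X U => [|b IHb] c Y V A T D X U def_b lt_c /= small none.
  by lia.
have okf := guess_ok c.
eapply ev_le.
  rewrite /state; exec_instr; exec_instr.
  apply: (@scan (b * (n.+1 * (14 * n + 45)) + 10 * n.+1 + 1)) => //=; try by lia.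
  move=> Y1 V1 A1 T1 D1 X1 U1 small1; rewrite addnK subn0.
  case: ifP => [acc_c|/negbT nacc_c].
    apply: ev_done; first by apply: state_bounded.
    by left; split=> //; exists c.
  eapply ev_le.
    rewrite /state; exec_instr.
    rewrite (_ : base + 0 = base + 2 * 0); last by lia.
    rewrite (mem_ext (g := fun u => if u <= 2 * 0 then 0 else guess c u)).
      apply: (@increment (b * (n.+1 * (14 * n + 45)))) => //=; try by lia.
      move=> A' T' D' f' small' okf' def_f'; case: ifP def_f' => lt_c1 def_f'.
        rewrite def_f' //; apply: IHb => //=; try by lia.
        by move=> c'; rewrite ltnS leq_eqVlt => /orP[/eqP->//|]; apply: none.
      apply: ev_done; first by apply: state_bounded => //=; lia.
      right; split=> // -[g lt_g]; apply/negP.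
      have : g <= c by lia.
      by rewrite leq_eqVlt => /orP[/eqP->//|]; apply: none.
    by move=> u _; case: ifP => //; rewrite leqn0 => /eqP->.
  by lia.
by rewrite subn0; nia.
Qed.

Ltac exec_init := eapply ev_step;
  [ by apply: input_state_bounded; rewrite /=; lia
  | by rewrite /step /current /matcher /set_reg /reg /=; reflexivity
  | ].

Lemma run_matcher :
  EV (n.+1 ^ h * (n.+1 * (14 * n + 45)) + 15) (Config 0 [::] input) answer.
Proof.
have okf := guess_ok 0; eapply ev_le.
  exec_init; exec_init; exec_init; exec_init; exec_init; exec_init. exec_init.
  rewrite ifT; last by lia.
  exec_init; exec_init; exec_init; exec_init; exec_init; exec_init.
  exec_init.
  (* Memory is still the bare input. Writing the sentinel beyond its end pads with zeros, which
     yields exactly the table of guess 0. *)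
  rewrite -size_input -[X in set_nth 0 X]cats0 set_nth_cat.
  rewrite (_ : set_nth _ _ _ _ = mkseq (guess 0) (l + 2)).
    by rewrite size_input; apply: (@search (n.+1 ^ h)) => //=; lia.
  apply: (@eq_from_nth _ 0) => [|u]; rewrite size_set_nth ?size_mkseq /=; first by lia.
  move=> lt_u; rewrite nth_set_nth /= nth_nil nth_mkseq; last by lia.
  rewrite /guess !addn1; case: eqP => // _; case: ifP => // _.
  by elim: (u./2.-1) => [|i IHi] /=; rewrite ?mod0n ?div0n.
by lia.
Qed.

End Machine.

Lemma run_matcher_large (P Q : seq (nat * nat)) :
    {in P, forall p, 0 < p.1 <= size P /\ p.2 <= size P} ->
    {in Q, forall p, 0 < p.1 <= size Q /\ p.2 <= size Q} -> size Q < size P ->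
  ev matcher
    (bounded (4 * (size P + size Q) + 8) (3 * size P + 2 * size Q + 4)) 15
    (Config 0 [::] [:: size P, size Q & flat P ++ flat Q])
    (fun c => current matcher c = Reject).
Proof.
move=> P_x Q_x lt_QP; have input_ok := input_state_bounded P_x Q_x.
eapply ev_le.
  do 7 (eapply ev_step;
    [ apply: input_ok; rewrite /=; lia
    | by rewrite /step /current /matcher /set_reg /reg /=; reflexivity
    | ]).
  rewrite ifF; last by lia.
  by apply: ev_done; first by apply: input_ok; rewrite /=; lia.
by [].
Qed.

(** * Greedy matching and point lists of permutations *)

Lemma greedyP (f : nat -> nat) (us xs : seq nat) :
  reflect (exists2 zs, subseq zs xs & all2 (fit f) us zs) (greedy f us xs).
Proof.
apply: (iffP idP) => [|[zs]].
  elim: xs us => [|x xs IHxs] [|u us] //=; try by exists [::].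
  case: ifP => fit_ux /IHxs[zs zs_xs us_zs].
    by exists (x :: zs); rewrite /= ?eqxx ?fit_ux.
  by exists zs => //; apply: subseq_trans zs_xs (subseq_cons _ _).
elim: xs us zs => [|x xs IHxs] [|u us] [|z zs] //=.
move=> sub_zs /andP[fit_uz us_zs]; case: eqP sub_zs => [eq_zx|_] sub_zs.
  by rewrite -eq_zx fit_uz; apply: IHxs us_zs.
case: ifP => _; last by apply: (IHxs _ (z :: zs)) => //=; rewrite fit_uz.
(* Exchange: [x] fits [u] but the solution uses a later [z]; matching [u] with [x] instead leaves
   [zs] inside [xs]. *)
by apply: IHxs us_zs; apply: subseq_trans sub_zs; apply: subseq_cons.
Qed.

Definition permutation_points (s : seq (nat * nat)) : Prop :=
  forall a, uniq (map (Defs.coord a) s) /\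
    map (Defs.coord a) s =i iota 1 (size s).

Definition embeds (P Q : seq (nat * nat)) : Prop :=
  exists2 f : nat -> nat, forall i, i < size P -> f i < size Q &
    forall a i j, i < size P -> j < size P ->
      (Defs.coord a (nth (0, 0) P i) < Defs.coord a (nth (0, 0) P j)) =
      (Defs.coord a (nth (0, 0) Q (f i)) < Defs.coord a (nth (0, 0) Q (f j))).

Section PermutationPoints.
Variable s : seq (nat * nat).
Hypothesis s_perm : permutation_points s.

Lemma coord_nth a i : i < size s -> 0 < Defs.coord a (nth (0, 0) s i) <= size s.
Proof.
move=> lt_i; have [_ /(_ (Defs.coord a (nth (0, 0) s i)))] := s_perm a.
by rewrite map_f ?mem_nth // mem_iota; lia.
Qed.

Lemma nth_coord a v (i := index v (map (Defs.coord a) s)) :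
  0 < v <= size s -> i < size s /\ Defs.coord a (nth (0, 0) s i) = v.
Proof.
move=> v_s; have v_in : v \in map (Defs.coord a) s.
  by have [_ ->] := s_perm a; rewrite mem_iota; lia.
have lt_i : i < size s by rewrite -(size_map (Defs.coord a)) index_mem.
by rewrite -(nth_map _ 0) // nth_index.
Qed.

Lemma index_coord a i :
  i < size s -> index (Defs.coord a (nth (0, 0) s i)) (map (Defs.coord a) s) = i.
Proof.
move=> lt_i; have [s_uniq _] := s_perm a.
by rewrite -(nth_map _ 0) // index_uniq ?size_map.
Qed.

Lemma lookup_nth i :
  i < size s -> lookup s (nth (0, 0) s i).2 = (nth (0, 0) s i).1.
Proof. by move=> lt_i; rewrite /lookup (index_coord Axis2). Qed.

Lemma coord_inj a i j : i < size s -> j < size s ->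
  Defs.coord a (nth (0, 0) s i) = Defs.coord a (nth (0, 0) s j) -> i = j.
Proof.
by move=> lt_i lt_j eq_ij; rewrite -(index_coord a lt_i) eq_ij index_coord.
Qed.

End PermutationPoints.

Lemma ltn_sorted_subseq (s1 s2 : seq nat) : sorted ltn s1 -> sorted ltn s2 ->
  {subset s1 <= s2} -> subseq s1 s2.
Proof.
move=> s1_sorted s2_sorted sub_s.
suff -> : s1 = [seq x <- s2 | x \in s1] by apply: filter_subseq.
apply: (irr_sorted_eq ltn_trans ltnn) => //.
  exact: (sorted_filter ltn_trans).
by move=> x; rewrite mem_filter; case: (boolP (x \in s1)) => // /sub_s ->.
Qed.

Lemma homo_interval (g : nat -> nat) (l : nat) :
    (forall u, 0 < u < l -> g u < g u.+1) ->
  forall u v, 0 < u -> u < v <= l -> g u < g v.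
Proof.
move=> g_step u v u_gt0; elim: v => [|v IHv] /andP[]; first by lia.
rewrite ltnS leq_eqVlt => /orP[/eqP<- le_ul|lt_uv le_vl].
  by apply: g_step; lia.
by apply: ltn_trans (IHv _) (g_step _ _); lia.
Qed.

(** * Accepted guesses and embeddings *)

Section Embedding.
Variables P Q : seq (nat * nat).
Hypothesis P_perm : permutation_points P.
Hypothesis Q_perm : permutation_points Q.
Local Notation l := (size P).
Local Notation n := (size Q).

(** At an odd point the entry is free, so its image lies strictly between the neighbouring entries.
    An even entry thus exceeds the image on its left, so it is nonzero and [fit] makes it the image
    itself; consecutive images are then compared through it. *)
Lemma fit_guess_homo c (g : nat -> nat) :
    (forall u, 0 < u <= l -> fit (guess P Q c) u (g u)) ->
  forall u v, 0 < u -> u < v <= l -> g u < g v.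
Proof.
move=> g_fit.
have g_odd u : 0 < u <= l -> odd u ->
    guess P Q c u.-1 < g u < guess P Q c u.+1.
  move=> ul odd_u; have := g_fit u ul; rewrite /fit ifT //.
  by rewrite {1}/guess ifF ?odd_u //; lia.
have g_even u : 0 < u <= l -> ~~ odd u -> g u = guess P Q c u.
  move=> ul even_u; have /andP[_] : guess P Q c u.-2 < g u.-1 < guess P Q c u.-1.+1.
    by apply: g_odd; lia.
  rewrite prednK; last by lia.
  by have := g_fit u ul; rewrite /fit; case: eqP => [->|_ /eqP].
apply: homo_interval => u ul; have [odd_u|even_u] := boolP (odd u).
  by rewrite (g_even u.+1); have := @g_odd u; rewrite /= ?odd_u; lia.
by rewrite g_even; have := @g_odd u.+1; rewrite /= ?even_u; lia.
Qed.

Lemma guess_complete (g : nat -> nat) :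
    (forall u, g u <= n) -> (forall u, 0 < u <= l -> 0 < g u) ->
    (forall u v, 0 < u -> u < v <= l -> g u < g v) ->
  exists2 c, c < n.+1 ^ l./2 & forall u, 0 < u <= l -> fit (guess P Q c) u (g u).
Proof.
move=> g_n g_gt0 g_homo.
have [|c lt_c digit_c] := @digit_surj n l./2 (fun i => g (2 * i + 2)).
  by move=> i.
exists c => // u ul.
have guess_even v : 0 < v <= l -> ~~ odd v -> guess P Q c v = g v.
  move=> vl even_v; rewrite /guess !ifF; try by lia.
  by rewrite digit_c; [congr g; lia | lia].
have := g_n u; have := g_gt0 u ul; rewrite /fit.
have [odd_u|even_u] := boolP (odd u); last first.
  by rewrite guess_even // eqxx; case: eqP; lia.
move=> gt0_gu gu; rewrite ifT; last by rewrite /guess ifF ?odd_u //; lia.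
apply/andP; split.
  (* At the two ends the neighbours are entry 0, which holds 0, and the sentinel [n.+1]. *)
  have [u1|u1] := eqVneq u 1; first by rewrite {1}u1.
  by rewrite guess_even; [apply: g_homo; lia | lia | lia].
have [ul1|ul1] := eqVneq u l; first by rewrite /guess eqSS ul1 eqxx -ul1.
by rewrite guess_even; [apply: g_homo; lia | lia | rewrite /= odd_u].
Qed.

Lemma accepting_embeds c : accepting P Q c -> embeds P Q.
Proof.
case/greedyP => zs /subseqP[b size_b ->]; rewrite -map_mask.
(* The mask that selects the matched x-coordinates is moved to the values: [ys] is increasing, and
   value [i.+1] of sigma is matched with its entry [i]. *)
set ys := mask b (iota 1 n) => fit_zs.
have sub_ys : subseq ys (iota 1 n) by apply: mask_subseq.
have size_ys : size ys = l.
  by move: fit_zs; rewrite all2E !size_map size_iota => /andP[/eqP].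
have ys_n i : i < l -> 0 < nth 0 ys i <= n.
  move=> lt_i; have : nth 0 ys i \in iota 1 n.
    by apply: (mem_subseq sub_ys); rewrite mem_nth ?size_ys.
  by rewrite mem_iota; lia.
have ys_sorted i j : i < j -> j < l -> nth 0 ys i < nth 0 ys j.
  move=> lt_ij lt_j; have : sorted ltn ys.
    by apply: subseq_sorted sub_ys (iota_ltn_sorted _ _); apply: ltn_trans.
  by move/(sorted_ltn_nth ltn_trans); apply; rewrite ?inE ?size_ys //; lia.
have fit_ys i : i < l ->
    fit (guess P Q c) (lookup P i.+1) (lookup Q (nth 0 ys i)).
  move=> lt_i; move: fit_zs; rewrite all2E => /andP[_ /(all_nthP (0, 0))].
  move=> /(_ i); rewrite size_zip !size_map size_iota size_ys minnn.
  move=> /(_ lt_i); rewrite nth_zip ?size_map ?size_iota ?size_ys //=.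
  by rewrite !(nth_map 0) ?size_iota ?size_ys // nth_iota.
pose w i := nth 0 ys (nth (0, 0) P i).2.-1.
have P2 i : i < l -> 0 < (nth (0, 0) P i).2 <= l.
  exact: (coord_nth P_perm Axis2).
have w_n i : i < l -> 0 < w i <= n.
  by move=> lt_i; apply: ys_n; have := P2 i lt_i; lia.
pose f i := index (w i) (map (Defs.coord Axis2) Q).
have f_lt i : i < l -> f i < n /\ (nth (0, 0) Q (f i)).2 = w i.
  by move=> lt_i; apply: (nth_coord Q_perm Axis2); apply: w_n.
have fit_f i : i < l ->
    fit (guess P Q c) (nth (0, 0) P i).1 (nth (0, 0) Q (f i)).1.
  move=> lt_i; have [lt_fi Q_fi] := f_lt i lt_i.
  have := fit_ys (nth (0, 0) P i).2.-1; rewrite prednK; last by have := P2 i lt_i; lia.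
  rewrite (lookup_nth P_perm) // -/(w i) -Q_fi (lookup_nth Q_perm) //.
  by apply; have := P2 i lt_i; lia.
exists f => [i /f_lt[] //|a i j lt_i lt_j].
(* Coordinates on an axis are distinct, so strict monotonicity in one direction gives the
   equivalence. *)
suff homo i' j' : i' < l -> j' < l ->
    Defs.coord a (nth (0, 0) P i') < Defs.coord a (nth (0, 0) P j') ->
    Defs.coord a (nth (0, 0) Q (f i')) < Defs.coord a (nth (0, 0) Q (f j')).
  apply/idP/idP => [|lt_Q]; first exact: homo.
  case: ltngtP => // [/homo|/(coord_inj P_perm)] lt_P.
    by have := lt_P lt_j lt_i; lia.
  by move: lt_Q; rewrite lt_P ?ltnn.
move=> lt_i' lt_j'; case: a => /=; last first.
  move=> lt_P; rewrite !(f_lt _ _).2 //; apply: ys_sorted.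
    by have := P2 i' lt_i'; lia.
  by have := P2 j' lt_j'; lia.
pose g u := (nth (0, 0) Q (f (index u (map (Defs.coord Axis1) P)))).1.
have g_f r : r < l -> g (nth (0, 0) P r).1 = (nth (0, 0) Q (f r)).1.
  by move=> lt_r; rewrite /g (index_coord P_perm Axis1).
rewrite -!g_f // => lt_P; apply: (@fit_guess_homo c) => [u ul||].
- have [lt_r /= P_r] := nth_coord P_perm Axis1 ul.
  by rewrite -{1}P_r; apply: fit_f.
- by have /= := coord_nth P_perm Axis1 lt_i'; lia.
- by have /= := coord_nth P_perm Axis1 lt_j'; lia.
Qed.

Lemma embeds_size : embeds P Q -> l <= n.
Proof.
case=> f f_lt f_mono; rewrite -(size_iota 0 l) -(size_map f) -(size_iota 0 n).
apply: uniq_leq_size => [|j /mapP[i]]; last first.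
  by rewrite !mem_iota => /= /f_lt lt_f ->.
rewrite map_inj_in_uniq ?iota_uniq // => i j.
rewrite !mem_iota /= => lt_i lt_j eq_f.
apply: (coord_inj P_perm (a := Axis1)) => //=.
have := f_mono Axis1 i j lt_i lt_j; have := f_mono Axis1 j i lt_j lt_i.
by rewrite eq_f ltnn /=; lia.
Qed.

Lemma embeds_accepting : embeds P Q ->
  exists2 c, c < n.+1 ^ l./2 & accepting P Q c.
Proof.
case=> f f_lt f_mono.
pose g u := (nth (0, 0) Q (f (index u (map (Defs.coord Axis1) P)))).1.
have f_x u : 0 < u <= l -> f (index u (map (Defs.coord Axis1) P)) < n.
  by move=> /(nth_coord P_perm Axis1)[/f_lt].
have f_y v : 0 < v <= l -> f (index v (map (Defs.coord Axis2) P)) < n.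
  by move=> /(nth_coord P_perm Axis2)[/f_lt].
have g_gt0 u : 0 < u <= l -> 0 < g u.
  by move=> /f_x/(coord_nth Q_perm Axis1)/andP[].
have g_le u : g u <= n.
  rewrite /g; set i := f _; have [lt_in|le_ni] := ltnP i n.
    by have /andP[] := coord_nth Q_perm Axis1 lt_in.
  by rewrite nth_default.
have g_homo u v : 0 < u -> u < v <= l -> g u < g v.
  move=> u_gt0 uv; have [|lt_i P_i] := nth_coord P_perm Axis1 (v := u); first lia.
  have [|lt_j P_j] := nth_coord P_perm Axis1 (v := v); first lia.
  rewrite /g -[_ < _](f_mono Axis1) // P_i P_j; lia.
have [c lt_c fit_c] := guess_complete g_le g_gt0 g_homo.
exists c => //; apply/greedyP.
pose w v := (nth (0, 0) Q (f (index v (map (Defs.coord Axis2) P)))).2.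
(* The images of the values of sigma increase, so they can be met in this order by the scan; their
   x-coordinates are the matching sought. *)
have sub_w : subseq (map w (iota 1 l)) (iota 1 n).
  apply: ltn_sorted_subseq (iota_ltn_sorted _ _) _.
    apply: (homo_sorted_in (P := fun v => 0 < v <= l)) (iota_ltn_sorted 1 l).
      move=> u v; rewrite !unfold_in => ul vl lt_uv /=.
      have [//|lt_i P_i] := nth_coord P_perm Axis2 (v := u).
      have [//|lt_j P_j] := nth_coord P_perm Axis2 (v := v).
      by rewrite /w -[_ < _](f_mono Axis2) // P_i P_j.
    by apply/allP => v; rewrite mem_iota; lia.
  move=> y /mapP[v]; rewrite mem_iota => vl ->.
  have /f_y lt_f : 0 < v <= l by lia.
  by have := coord_nth Q_perm Axis2 lt_f; rewrite mem_iota /= -/(w v); lia.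
exists (map (lookup Q) (map w (iota 1 l))); first exact: map_subseq.
rewrite all2E !size_map eqxx /=; apply/(all_nthP (0, 0)) => i.
rewrite size_zip !size_map size_iota minnn => lt_i.
rewrite nth_zip ?size_map //= !(nth_map 0) ?size_map ?size_iota // nth_iota //.
have [|lt_j P_j] := nth_coord P_perm Axis2 (v := 1 + i); first lia.
rewrite /w (lookup_nth Q_perm); last by apply: f_y; lia.
by have := fit_c _ (coord_nth P_perm Axis1 lt_j); rewrite /g index_coord.
Qed.

End Embedding.

(** * From labelled permutations to point lists *)

Definition points (s : permutation) : seq (nat * nat) :=
  [seq point_at s i | i <- iota 1 (plength s)].

Lemma encodeE (s t : permutation) :
  encode s t =
    [:: size (points s), size (points t) & flat (points s) ++ flat (points t)].
Proof.
by rewrite /encode /encode_points /flat !size_map !size_iota -!map_comp.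
Qed.

Section Reduced.
Variable s : permutation.
Hypothesis s_reduced : reduced s.

Lemma label_in i : i < plength s -> i.+1 \in labels s.
Proof. by move=> lt_i; rewrite s_reduced.1; lia. Qed.

Lemma label_lt (p : labels s) : (val p).-1 < plength s.
Proof. by have := valP p; rewrite s_reduced.1; lia. Qed.

Lemma nth_points (p : labels s) : nth (0, 0) (points s) (val p).-1 = Defs.point p.
Proof.
rewrite (nth_map 0) ?size_iota ?label_lt // nth_iota ?label_lt //.
by rewrite add1n prednK ?labels_gt0 // /point_at valK.
Qed.

Lemma points_label i (lt_i : i < plength s) :
  nth (0, 0) (points s) i = Defs.point [` label_in lt_i]%fset.
Proof. exact: (nth_points [` label_in lt_i]%fset). Qed.

Lemma reduced_points : permutation_points (points s).
Proof.
move=> a; have size_s : size (points s) = plength s.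
  by rewrite size_map size_iota.
have uniq_s : uniq (map (Defs.coord a) (points s)).
  apply/(uniqP 0) => i j; rewrite !inE !size_map !size_iota => lt_i lt_j.
  rewrite !(nth_map (0, 0)) ?size_s // !points_label => eq_ij.
  apply/eqP/negPn/negP => ne_ij; apply: point_general eq_ij => /(congr1 val) /=.
  by case=> eq_ij; rewrite eq_ij eqxx in ne_ij.
have sub_s : {subset map (Defs.coord a) (points s) <= iota 1 (size (points s))}.
  move=> x /mapP[q /(nthP (0, 0))[i]]; rewrite size_s => lt_i <- ->.
  rewrite points_label mem_iota.
  by have := s_reduced.2 a [` label_in lt_i]%fset; lia.
have le_s :
    size (iota 1 (size (points s))) <= size (map (Defs.coord a) (points s)).
  by rewrite size_iota size_map.
by split=> //; case: (uniq_min_size uniq_s sub_s le_s).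
Qed.

End Reduced.

Lemma contains_embeds (s t : permutation) : reduced s -> reduced t ->
  contains_pattern s t <-> embeds (points s) (points t).
Proof.
move=> s_red t_red; rewrite /embeds !size_map !size_iota; split.
  case=> phi phi_emb.
  pose p i lt_i := [` @label_in s s_red i lt_i]%fset.
  have insub_p i lt_i : insub i.+1 = Some (p i lt_i) by apply: (valK (p i lt_i)).
  exists (fun i => if insub i.+1 is Some p then (val (phi p)).-1 else 0).
    by move=> i lt_i; rewrite insub_p; apply: label_lt.
  move=> a i j lt_i lt_j; rewrite !insub_p !nth_points // !points_label.
  by apply/idP/idP => /(phi_emb a).
case=> f f_lt f_mono.
exists (fun p => [` label_in t_red (f_lt _ (label_lt s_red p))]%fset) => a p q.
rewrite /plt -!points_label -!(nth_points s_red).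
by rewrite f_mono //; apply: label_lt.
Qed.

(** Space is bounded at all times, whereas [ev] stops at halting; from there on the configuration is
    a fixed point. *)
Lemma ev_iter prog (G : pred config) b c (Q : config -> Prop) :
    (forall c', Q c' -> step prog c' = c') -> ev prog G b c Q ->
  exists2 t, t <= b & Q (iter t (step prog) c) /\
    forall i, G (iter i (step prog) c).
Proof.
move=> halt [t le_tb [Qt Gt]]; exists t => //; split=> // i.
have [/Gt//|/ltnW lt_ti] := leqP i t.
rewrite -(subnK lt_ti) iterD; set c' := iter t _ _ in Qt Gt *.
suff -> : iter (i - t) (step prog) c' = c' by apply: Gt.
by elim: (i - t) => //= j ->; apply: halt.
Qed.

Lemma matcher_decides (s t : permutation) (l := plength s) (n := plength t) :
    reduced s -> reduced t ->
  exists2 T,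
    T <= (if l <= n then n.+1 ^ l./2 * (n.+1 * (14 * n + 45)) else 0) + 15 &
    decides_at matcher (encode s t) (contains_pattern s t) T /\
    forall i, bounded (4 * (l + n) + 8) (3 * l + 2 * n + 4)
      (run matcher (encode s t) i).
Proof.
move=> s_red t_red.
have size_s : size (points s) = l by rewrite size_map size_iota.
have size_t : size (points t) = n by rewrite size_map size_iota.
have s_perm := reduced_points s_red; have t_perm := reduced_points t_red.
have surj u : permutation_points u -> {subset iota 1 (size u) <= unzip2 u}.
  by move=> u_perm x; rewrite -(u_perm Axis2).2.
have small u : permutation_points u ->
    {in u, forall p, 0 < p.1 <= size u /\ p.2 <= size u}.
  move=> u_perm p /(nthP (0, 0))[i lt_i <-].
  have := coord_nth u_perm Axis1 lt_i.
  by have /andP[_] := coord_nth u_perm Axis2 lt_i.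
rewrite encodeE -/l -/n -size_s -size_t /decides_at /run.
have [le_st|lt_ts] := leqP (size (points s)) (size (points t)).
  have [|T le_T [dec bnd]] := ev_iter _ (run_matcher (surj _ s_perm)
    (surj _ t_perm) (small _ s_perm) (small _ t_perm) le_st).
    by rewrite /answer /step => c [] [->].
  exists T => //; split=> //.
  have iff_acc : (exists2 g, g < (size (points t)).+1 ^ (size (points s))./2 &
      accepting (points s) (points t) g) <-> contains_pattern s t.
    rewrite contains_embeds //; split; last exact: embeds_accepting.
    by case=> c _; apply: accepting_embeds.
  by case: dec => [[-> acc]|[-> acc]]; [left | right]; rewrite -iff_acc.
have [|T le_T [dec bnd]] := ev_iter _
    (run_matcher_large (small _ s_perm) (small _ t_perm) lt_ts).
  by rewrite /step => c ->.
exists T => //; split=> //; right; split=> //.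
by rewrite contains_embeds // => /(embeds_size s_perm); rewrite leqNgt lt_ts.
Qed.

(** * Bounds on space, words and time *)

Lemma bits_le v : bits v <= v.+1.
Proof.
rewrite /bits ltnS; have [->|v_gt0] := posnP v; first by rewrite trunc_log0.
have /andP[le_v _] := @trunc_log_bounds 2 v isT v_gt0.
by apply: leq_trans le_v; apply/ltnW/ltn_expl.
Qed.

Lemma bounded_bits (s : nat) (m k : nat) (c : config) : m <= 8 * s.+1 ->
  bounded m k c -> all (fun v => bits v <= 5 * bits s) (words c).
Proof.
move=> le_m /and4P[_ regs_c _ mem_c]; apply/allP => v v_c.
have le_v : v <= m.
  by move: v_c; rewrite mem_cat => /orP[/(allP regs_c)|/(allP mem_c)].
(* Since [s < 2 ^ bits s], the value has at most [bits s + 4] bits, and [bits s >= 1] turns this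
   into the factor 5. *)
have : bits v <= trunc_log 2 (2 ^ (bits s + 3)) + 1.
  rewrite /bits addn1 ltnS leq_trunc_log //.
  by have := @trunc_log_ltn 2 s isT; rewrite expnD /bits; lia.
by rewrite trunc_expnK // /bits; lia.
Qed.

Lemma bounded_space (m k : nat) (c : config) :
  bounded m k c -> space_used c <= (17 + k) * m.+1.
Proof.
move=> /and4P[regs17 regs_c memk mem_c].
rewrite /space_used; apply: (@leq_trans (\sum_(v <- words c) m.+1)).
  rewrite big_seq [leqRHS]big_seq; apply: leq_sum => v.
  rewrite mem_cat => v_c; apply: leq_trans (bits_le v) _; rewrite ltnS.
  by case/orP: v_c => [/(allP regs_c)|/(allP mem_c)].
rewrite big_const_seq count_predT iter_addn_0 mulnC leq_mul2r size_cat.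
by rewrite leq_add ?orbT.
Qed.

(** Division-free form of (1 + 1/n)^k (1 - k/n) <= 1, a Bernoulli-type inequality. For k at most n/2
    the second factor is at least 1/2, whence the factor 2 in [expSn_le]. *)
Lemma expSn_sub (n k : nat) : n.+1 ^ k * (n - k) <= n ^ k.+1.
Proof.
elim: k => [|k IHk]; first by rewrite expn1 subn0 mul1n.
rewrite expnS [n ^ k.+2]expnS; apply: leq_trans (leq_mul (leqnn n) IHk).
have le_n : n.+1 * (n - k.+1) <= n * (n - k).
  by rewrite subnS; have := leq_subr k n; case: (n - k) => [|r] /=; nia.
by rewrite -mulnA mulnCA [n * _]mulnCA leq_mul2l le_n orbT.
Qed.

Lemma expSn_le (n k : nat) : 0 < n -> k.*2 <= n -> n.+1 ^ k <= 2 * n ^ k.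
Proof.
move=> n_gt0 le_kn; rewrite -(leq_pmul2r n_gt0) -mulnA -expnSr.
apply: leq_trans (leq_mul (leqnn 2) (expSn_sub n k)).
by rewrite mulnCA leq_mul2l; lia.
Qed.

Lemma time_bound (n h : nat) : h.*2 <= n ->
  n.+1 ^ h * (n.+1 * (14 * n + 45)) + 15 <= 300 * maxn n 1 ^ (h + 2).
Proof.
case: n => [|n] le_hn; first by have -> : h = 0 by lia.
rewrite (maxn_idPl _) // expnD.
have le1 := @expSn_le n.+1 h isT le_hn.
(* 118 is attained at size 1, and [2 * 118 + 15] stays below 300. *)
have le2 : n.+2 * (14 * n.+1 + 45) <= 118 * n.+1 ^ 2 by nia.
have gt0 : 0 < n.+1 ^ h * n.+1 ^ 2 by rewrite muln_gt0 !expn_gt0.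
have := leq_mul le1 le2; move: gt0.
by set a := _ * _; set b := _ ^ h; nia.
Qed.

Local Open Scope classical_set_scope.
Local Open Scope ring_scope.

Lemma cst_littleo_natr (R : realType) (a : R) :
  (fun _ : nat => a) =o_\oo (fun l : nat => l%:R : R).
Proof.
apply/eqoP => e e_gt0; near=> l.
rewrite normr_nat -ler_pdivrMl //; near: l.
exact: nbhs_infty_ger.
Unshelve. all: by end_near. Qed.

Theorem theorem8 (R : realType) :
  exists (prog : seq instr) (g : nat -> R) (C k : nat),
    g =o_\oo (fun l : nat => l%:R : R) /\
    forall sigma pi : permutation, reduced sigma -> reduced pi ->
      let l := plength sigma in
      let n := plength pi in
      let input := encode sigma pi in
      exists T : nat,
        [/\ decides_at prog input (contains_pattern sigma pi) T,
            T%:R <= C%:R * (maxn n 1)%:R `^ (l%:R / 2 + g l),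
            forall t : nat, (space_used (run prog input t) <= C * (l + n + 1) ^ k)%N
          & forall t : nat,
              all (fun v => (bits v <= C * bits (l + n))%N)
                  (words (run prog input t))].
Proof.
(* The exponent 2 absorbs the quadratic cost of a guess. The space has degree 2 because the number
   of words and the values they hold are both linear in [l + n], each word being charged its value
   plus one. *)
exists matcher, (fun=> 2), 300%N, 2%N; split; first exact: cst_littleo_natr.
move=> sigma pi sigma_red pi_red l n input.
have [T le_T [dec bnd]] := matcher_decides sigma_red pi_red.
exists T; split=> // [|t|t].
- set N := maxn n 1; have N_ge1 : 1 <= N%:R :> R by rewrite ler1n leq_maxr.
  (* Exponent 0 covers the immediate rejection, within 15 steps, when [l > n]. *)
  have le_T' : (T <= 300 * N ^ (if (l <= n)%N then l./2 + 2 else 0))%N.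
    apply: leq_trans le_T _; rewrite -/l -/n; case: ifP => // le_ln.
    by apply: time_bound; lia.
  apply: (@le_trans _ _ (300 * N ^ (if (l <= n)%N then l./2 + 2 else 0))%:R).
    by rewrite ler_nat.
  rewrite natrM natrX ler_wpM2l // -powR_mulrn // ler_powR //.
  case: ifP => _; last by rewrite addr_ge0 // divr_ge0.
  rewrite natrD lerD2r ler_pdivlMr // -natrM ler_nat; lia.
- apply: leq_trans (bounded_space (bnd t)) _; rewrite -/l -/n.
  by rewrite expnS expn1; nia.
- have le_m : (4 * (l + n) + 8 <= 8 * (l + n).+1)%N by lia.
  apply: sub_all (bounded_bits le_m (bnd t)) => v /leq_trans; apply.
  by rewrite leq_mul2r orbT.
Qed.
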